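(* Let $CC$ be a C-system and $F:CC^{op}\to Sets$ a presheaf on the category underlying $CC$. Then the C0-system $CC[F]$ (the $F$-extension of $CC$) is a C-system.
   Context: Composition is in diagrammatic order: $f\circ g$ means first $f$, then $g$. A C0-system is a category $CC$ with a length function $l:Ob(CC)\to\mathbb N$, an object $pt$, a function $ft:Ob(CC)\to Ob(CC)$, morphisms $p_X:X\to ft(X)$, and, for $l(X)>0$ and $f:Y\to ft(X)$, an object $f^*(X)$ and a morphism $q(f,X):f^*(X)\to X$, such that: $l^{-1}(0)=\{pt\}$; $l(ft(X))=l(X)-1$ if $l(X)>0$; $ft(pt)=pt$; $pt$ is final; $l(f^*(X))>0$, $ft(f^*(X))=Y$ and $q(f,X)\circ p_X=p_{f^*(X)}\circ f$; $Id_{ft(X)}^*(X)=X$ and $q(Id_{ft(X)},X)=Id_X$; and for $g:Z\to Y$, $(g\circ f)^*(X)=g^*(f^*(X))$ and $q(g\circ f,X)=q(g,f^*(X))\circ q(f,X)$. A C-system is a C0-system with an operation assigning to each $f:Y\to X$ with $l(X)>0$ a morphism $s_f:Y\to(ft(f))^*(X)$, where $ft(f)=f\circ p_X$, such that $s_f\circ p_{(ft(f))^*(X)}=Id_Y$, $f=s_f\circ q(ft(f),X)$, and $s_f=s_{f\circ q(g,Z)}$ whenever $X=g^*(Z)$ with $g:ft(X)\to ft(Z)$. Such an operation is unique if it exists, and it exists iff all canonical squares, formed by $q(f,X),p_X$ and $p_{f^*(X)},f$, are pull-backs; so being a C-system is a property of a C0-system. The C0-system $CC[F]$: objects are pairs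 $(X,\Gamma)$ with $X\in Ob(CC)$ and $\Gamma=(T_0,\dots,T_{l(X)-1})$, $T_j\in F(ft^{l(X)-j}(X))$, i.e. $Ob(CC[F])=\coprod_{X}F(ft^{l(X)}(X))\times\dots\times F(ft^2(X))\times F(ft(X))$ (empty product is a point). Morphisms $(X,\Gamma)\to(Y,\Gamma')$ are triples $((X,\Gamma),(Y,\Gamma'),f)$ with $f\in Mor_{CC}(X,Y)$, with composition and identities those of $CC$. $l(X,\Gamma)=l(X)$; $pt=(pt,())$; $ft(X,(T_0,\dots,T_{l(X)-1}))=(ft(X),(T_0,\dots,T_{l(X)-2}))$ if $l(X)>0$, and $ft(pt)=pt$; $p_{(X,\Gamma)}$ is given by $p_X$. For $l(Y)>0$, $\Gamma'=(T'_0,\dots,T'_{l(Y)-1})$, $\Gamma=(T_0,\dots,T_{l(X)-1})$ and $f:(X,\Gamma)\to ft(Y,\Gamma')$: $f^*((Y,\Gamma'))=(f^*(Y),(T_0,\dots,T_{l(X)-1},F(f)(T'_{l(Y)-1})))$ and $q(f,(Y,\Gamma'))$ is the morphism $f^*((Y,\Gamma'))\to(Y,\Gamma')$ given by $q(f,Y)$. *)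

(* Defs.v *)
From mathcomp Require Import all_boot.
From Stdlib Require Import ProofIrrelevance.

Set Implicit Arguments.
Unset Strict Implicit.
Unset Printing Implicit Defensive.

Declare Scope csys_scope.
Delimit Scope csys_scope with csys.

(* Composition is in diagrammatic order: [f ;; g] is first [f], then [g]. *)
Reserved Notation "f ;; g" (at level 50, left associativity).
Reserved Notation "f ≡ g" (at level 70, no associativity).

Record category := Category {
  ob :> Type;
  mor : ob -> ob -> Type;
  id_mor : forall X, mor X X;
  comp : forall X Y Z, mor X Y -> mor Y Z -> mor X Z;
  comp_idl : forall X Y (f : mor X Y), comp (id_mor X) f = f;
  comp_idr : forall X Y (f : mor X Y), comp f (id_mor Y) = f;
  comp_assoc : forall X Y Z W (f : mor X Y) (g : mor Y Z) (h : mor Z W),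
    comp f (comp g h) = comp (comp f g) h
}.
Arguments mor {c} X Y.
Arguments id_mor {c} X.
Arguments comp {c X Y Z} f g.

Notation "f ;; g" := (comp f g) : csys_scope.
Local Open Scope csys_scope.

(* The set of all morphisms of [C]. The equations of C-systems relate morphisms
   whose ends are equal but not convertible; they are equations in this set. *)
Record arrow (C : category) := Arrow {
  arr_dom : C;
  arr_cod : C;
  arr_mor : mor arr_dom arr_cod
}.
Arguments Arrow {C arr_dom arr_cod} arr_mor.

Notation "f ≡ g" := (Arrow f = Arrow g) : csys_scope.

Definition cast_cod (C : category) (X Y Y' : C) (e : Y = Y') (f : mor X Y) :
  mor X Y' := eq_rect Y (mor X) f Y' e.

Definition is_final (C : category) (T : C) : Prop :=
  forall X : C, exists f : mor X T, forall g : mor X T, g = f.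

Record presheaf (C : category) := Presheaf {
  psh_ob :> C -> Type;
  psh_mor : forall X Y : C, mor X Y -> psh_ob Y -> psh_ob X;
  psh_id : forall (X : C) (t : psh_ob X), psh_mor (id_mor X) t = t;
  psh_comp : forall (X Y Z : C) (f : mor X Y) (g : mor Y Z) (t : psh_ob Z),
    psh_mor (f ;; g) t = psh_mor f (psh_mor g t)
}.
Arguments psh_mor {C} p {X Y} f t.

Record C0system := C0System {
  c0_cat :> category;
  len : c0_cat -> nat;
  pt : c0_cat;
  ft : c0_cat -> c0_cat;
  p : forall X : c0_cat, mor X (ft X);
  (* [star hX f] is f^*(X) and [q hX f] is q(f, X). *)
  star : forall X Y : c0_cat, 0 < len X -> mor Y (ft X) -> c0_cat;
  q : forall (X Y : c0_cat) (hX : 0 < len X) (f : mor Y (ft X)),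
    mor (star hX f) X;
  len_eq0 : forall X : c0_cat, len X = 0 <-> X = pt;
  len_ft_gt0 : forall X : c0_cat, 0 < len X -> len (ft X) = len X - 1;
  ft_pt : ft pt = pt;
  pt_final : is_final pt;
  len_star : forall (X Y : c0_cat) (hX : 0 < len X) (f : mor Y (ft X)),
    0 < len (star hX f);
  ft_star : forall (X Y : c0_cat) (hX : 0 < len X) (f : mor Y (ft X)),
    ft (star hX f) = Y;
  q_p : forall (X Y : c0_cat) (hX : 0 < len X) (f : mor Y (ft X)),
    q hX f ;; p X = cast_cod (ft_star hX f) (p (star hX f)) ;; f;
  star_id : forall (X : c0_cat) (hX : 0 < len X), star hX (id_mor (ft X)) = X;
  q_id : forall (X : c0_cat) (hX : 0 < len X),
    q hX (id_mor (ft X)) ≡ id_mor X;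
  star_comp : forall (X Y Z : c0_cat) (hX : 0 < len X)
      (f : mor Y (ft X)) (g : mor Z Y),
    star hX (g ;; f)
    = star (len_star hX f) (cast_cod (esym (ft_star hX f)) g);
  q_comp : forall (X Y Z : c0_cat) (hX : 0 < len X)
      (f : mor Y (ft X)) (g : mor Z Y),
    q hX (g ;; f)
    ≡ q (len_star hX f) (cast_cod (esym (ft_star hX f)) g) ;; q hX f
}.
Arguments len {c} X.
Arguments pt {c}.
Arguments ft {c} X.
Arguments p {c} X.
Arguments star {c X Y} hX f.
Arguments q {c X Y} hX f.

Definition ft_mor (CC : C0system) (X Y : CC) (f : mor Y X) : mor Y (ft X) :=
  f ;; p X.

Record s_operation (CC : C0system) := SOperation {
  s : forall (X Y : CC) (hX : 0 < len X) (f : mor Y X),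
    mor Y (star hX (ft_mor f));
  s_p : forall (X Y : CC) (hX : 0 < len X) (f : mor Y X),
    cast_cod (ft_star hX (ft_mor f)) (s hX f ;; p (star hX (ft_mor f)))
    = id_mor Y;
  s_q : forall (X Y : CC) (hX : 0 < len X) (f : mor Y X),
    f = s hX f ;; q hX (ft_mor f);
  s_star : forall (X Y Z : CC) (hX : 0 < len X) (hZ : 0 < len Z)
      (g : mor (ft X) (ft Z)) (e : X = star hZ g) (f : mor Y X),
    s hX f ≡ s hZ (cast_cod e f ;; q hZ g)
}.

(* An s-operation on a given C0-system is unique if it exists, so being a
   C-system is a property. *)
Definition is_Csystem (CC : C0system) : Prop := inhabited (s_operation CC).

Lemma len_ft (CC : C0system) (X : CC) : len (ft X) = (len X).-1.
Proof.
case: (posnP (len X)) => [l0|/len_ft_gt0 ->]; last by rewrite subn1.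
by move/len_eq0: (l0) => eX; rewrite {1}eX ft_pt -eX l0.
Qed.

Lemma len_ftS (CC : C0system) (X : CC) : 0 < len X -> (len (ft X)).+1 = len X.
Proof. by rewrite len_ft; case: (len X). Qed.

Lemma len_pt (CC : C0system) : len (pt : CC) = 0.
Proof. exact/len_eq0. Qed.

Section Extension.
Variables (CC : C0system) (F : presheaf CC).

(* [tele n X] is F(ft^n(X)) * ... * F(ft^2(X)) * F(ft(X)). *)
Fixpoint tele (n : nat) (X : CC) : Type :=
  if n is n'.+1 then (tele n' (ft X) * F (ft X))%type else unit.

Definition cast_tele (m n : nat) (X : CC) (e : m = n) (G : tele m X) :
  tele n X := eq_rect m (fun k => tele k X) G n e.

(* (T_0, ..., T_{n-1}) |-> (T_0, ..., T_{n-2}), and () |-> () *)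
Definition tele_init (n : nat) (X : CC) : tele n X -> tele n.-1 (ft X) :=
  if n is _.+1 then fun G => G.1 else fun _ => tt.

(* (T_0, ..., T_{n-1}) |-> T_{n-1} *)
Definition tele_last (n : nat) (X : CC) : 0 < n -> tele n X -> F (ft X) :=
  match n with
  | 0 => fun h _ => False_rect _ (notF h)
  | _.+1 => fun _ G => G.2
  end.

(* (T_0, ..., T_{n-1}) and t give (T_0, ..., T_{n-1}, t), where n = l(X) and
   X = ft(W). *)
Definition tele_extend (W X : CC) (hW : 0 < len W) (e : ft W = X) :
    tele (len X) X -> F X -> tele (len W) W :=
  match e in _ = X0 return tele (len X0) X0 -> F X0 -> tele (len W) W with
  | erefl => fun G t => @cast_tele _ _ W (len_ftS hW) (G, t)
  end.

Record ext_ob := ExtOb {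
  base : CC;
  ctx : tele (len base) base
}.

(* The triples ((X, G), (Y, G'), f) are the elements of [arrow ext_cat]. *)
Definition ext_cat : category :=
  @Category ext_ob (fun A B => mor (base A) (base B))
    (fun A => id_mor (base A)) (fun A B D f g => f ;; g)
    (fun A B => @comp_idl CC (base A) (base B))
    (fun A B => @comp_idr CC (base A) (base B))
    (fun A B D E => @comp_assoc CC (base A) (base B) (base D) (base E)).

Definition ext_len (A : ext_cat) : nat := len (base A).

Definition ext_pt : ext_cat :=
  @ExtOb pt (@cast_tele 0 _ pt (esym (len_pt CC)) tt).

(* On the object pt this gives (ft(pt), ()), which is (pt, ()). *)
Definition ext_ft (A : ext_cat) : ext_cat :=
  @ExtOb (ft (base A)) (cast_tele (esym (len_ft _)) (tele_init (ctx A))).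

Definition ext_p (A : ext_cat) : mor A (ext_ft A) := p (base A).

Definition ext_star (B A : ext_cat) (hB : 0 < ext_len B)
    (f : mor A (ext_ft B)) : ext_cat :=
  let f0 : mor (base A) (ft (base B)) := f in
  @ExtOb (star hB f0)
    (tele_extend (len_star hB f0) (ft_star hB f0)
       (ctx A) (psh_mor F f0 (tele_last hB (ctx B)))).

Definition ext_q (B A : ext_cat) (hB : 0 < ext_len B)
    (f : mor A (ext_ft B)) : mor (ext_star hB f) B :=
  @q CC (base B) (base A) hB f.

Lemma cast_tele_id n X (e : n = n) (G : tele n X) : cast_tele e G = G.
Proof. by rewrite (eq_irrelevance e erefl). Qed.

Lemma cast_tele_comp m n k X (e : m = n) (e' : n = k) (G : tele m X) :
  cast_tele e' (cast_tele e G) = cast_tele (etrans e e') G.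
Proof. by case: k / e'. Qed.

Lemma tele_init_cast m n X (e : m = n) (G : tele m X) :
  tele_init (cast_tele e G) = cast_tele (congr1 predn e) (tele_init G).
Proof. by case: n / e. Qed.

Lemma tele_last_cast m n X (e : m = n) (h : 0 < n) (h' : 0 < m)
  (G : tele m X) : tele_last h (cast_tele e G) = tele_last h' G.
Proof. by case: n / e h => h; rewrite (bool_irrelevance h h'). Qed.

Lemma tele_eta m n X (h : 0 < n) (G : tele n X) (e : n.-1 = m)
  (e' : m.+1 = n) :
  cast_tele e' ((cast_tele e (tele_init G), tele_last h G) : tele m.+1 X) = G.
Proof.
by case: n h G e e' => [//|n] h [G t] /= e; case: m / e => e'; rewrite !cast_tele_id.
Qed.

Lemma ext_ob_eq (A : ext_cat) (X : CC) (e : base A = X)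
  (G : tele (len X) X) :
  ctx A = eq_rect_r (fun Y => tele (len Y) Y) G e -> A = @ExtOb X G.
Proof. by case: A e => Y G0 /= e; case: X / e G => G /= ->. Qed.

Lemma ext_ft_star (B A : ext_cat) (hB : 0 < ext_len B)
  (f : mor A (ext_ft B)) : ext_ft (ext_star hB f) = A.
Proof.
rewrite /ext_ft /ext_star /=; case: A f => X G /= f.
move: (psh_mor F f _) => t; move: (ft_star hB f) (len_star hB f).
move: (star hB f) => W e; case: X / e G t {f} => G t hW /=.
congr ExtOb; rewrite tele_init_cast cast_tele_comp /=.
exact: cast_tele_id.
Qed.

Lemma ext_cast_cod (A B D : ext_cat) (e : B = D) (e' : base B = base D)
  (f : mor A B) :
  (cast_cod e f : @mor CC (base A) (base D))
  = cast_cod e' (f : @mor CC (base A) (base B)).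
Proof. by case: D / e e' => e'; rewrite (proof_irrelevance _ e' erefl). Qed.

Lemma ext_arrow_eq (A B A' B' : ext_cat) (f : mor A B) (f' : mor A' B') :
  A = A' -> B = B' ->
  (f : @mor CC (base A) (base B)) ≡ (f' : @mor CC (base A') (base B')) ->
  f ≡ f'.
Proof.
move=> eA eB; case: A' / eA f'; case: B' / eB => f' ef.
have [eD [eC eM]] : exists (eD : base A = base A) (eC : base B = base B),
    eq_rect _ (fun Y => mor Y (base B)) (cast_cod eC f) _ eD = f'.
  pose P (a : arrow CC) := exists (eD : base A = arr_dom a)
    (eC : base B = arr_cod a),
    eq_rect _ (fun Y => mor Y (arr_cod a)) (cast_cod eC f) _ eD = arr_mor a.
  have : P (@Arrow CC _ _ f) by exists erefl, erefl.
  by rewrite ef.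
by rewrite -eM (proof_irrelevance _ eD erefl) (proof_irrelevance _ eC erefl).
Qed.

Lemma ext_len_eq0 (A : ext_cat) : ext_len A = 0 <-> A = ext_pt.
Proof.
split=> [|->]; last exact: len_pt.
case: A => X G; rewrite /ext_len /= => l0; move/len_eq0: (l0) => e.
apply: (@ext_ob_eq (ExtOb G) _ e) => /=.
have tele0 (H H' : tele (len X) X) : H = H'.
  by move: H H'; rewrite l0 => - [] [].
exact: tele0.
Qed.

Lemma ext_ft_pt : ext_ft ext_pt = ext_pt.
Proof. by apply/ext_len_eq0; rewrite /ext_len /= ft_pt len_pt. Qed.

Lemma ext_len_ft_gt0 (A : ext_cat) :
  0 < ext_len A -> ext_len (ext_ft A) = ext_len A - 1.
Proof. exact: len_ft_gt0. Qed.

Lemma ext_pt_final : is_final ext_pt.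
Proof. by move=> A; exact: pt_final. Qed.

Lemma ext_len_star (B A : ext_cat) (hB : 0 < ext_len B)
  (f : mor A (ext_ft B)) : 0 < ext_len (ext_star hB f).
Proof. exact: len_star. Qed.

Lemma ext_q_p (B A : ext_cat) (hB : 0 < ext_len B) (f : mor A (ext_ft B)) :
  ext_q hB f ;; ext_p B
  = cast_cod (ext_ft_star hB f) (ext_p (ext_star hB f)) ;; f.
Proof.
pose e : base (ext_ft (ext_star hB f)) = base A :=
  @ft_star CC (base B) (base A) hB f.
rewrite /= (ext_cast_cod _ e).
exact: (@q_p CC (base B) (base A) hB f).
Qed.

Lemma ext_star_id (B : ext_cat) (hB : 0 < ext_len B) :
  ext_star hB (id_mor (ext_ft B)) = B.
Proof.
case: B hB => Y G hB; rewrite /ext_star /= psh_id.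
move: (ft_star _ _) (len_star _ _) (star_id hB); rewrite /ext_len /= in hB *.
move: (star hB _) => W e hW eW; case: Y / eW hB G e => hB G e.
rewrite (proof_irrelevance _ e erefl) /=; congr ExtOb.
by rewrite tele_eta.
Qed.

Lemma ext_q_id (B : ext_cat) (hB : 0 < ext_len B) :
  ext_q hB (id_mor (ext_ft B)) ≡ id_mor B.
Proof.
by apply: ext_arrow_eq (ext_star_id hB) erefl _; exact: (@q_id CC (base B) hB).
Qed.

Lemma tele_last_extend (W X Z : CC) (hW hW' : 0 < len W) (e : ft W = X)
  (G : tele (len X) X) (t : F X) (g : mor Z X) :
  psh_mor F (cast_cod (esym e) g) (tele_last hW' (tele_extend hW e G t))
  = psh_mor F g t.
Proof.
by case: X / e G t g => G t g /=; rewrite (@tele_last_cast (len (ft W)).+1 _ _ _ hW' isT).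
Qed.

Lemma ext_ob_extend (W W' X : CC) (hW : 0 < len W) (hW' : 0 < len W')
  (e : ft W = X) (e' : ft W' = X) (G : tele (len X) X) (t t' : F X) :
  W = W' -> t = t' ->
  ExtOb (tele_extend hW e G t) = ExtOb (tele_extend hW' e' G t').
Proof.
move=> eW <-; case: W' / eW hW' e' => hW' e'.
by rewrite (proof_irrelevance _ e' e) (bool_irrelevance hW' hW).
Qed.

Lemma ext_star_comp (B A D : ext_cat) (hB : 0 < ext_len B)
  (f : mor A (ext_ft B)) (g : mor D A) :
  ext_star hB (g ;; f)
  = ext_star (ext_len_star hB f) (cast_cod (esym (ext_ft_star hB f)) g).
Proof.
have eg : (cast_cod (esym (ext_ft_star hB f)) g
           : @mor CC (base D) (ft (star hB f)))
          = cast_cod (esym (ft_star hB (f : @mor CC (base A) (ft (base B))))) g.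
  pose e : base A = base (ext_ft (ext_star hB f)) :=
    esym (@ft_star CC (base B) (base A) hB f).
  exact: (ext_cast_cod _ e).
rewrite {2}/ext_star {2}/ext_star /=; apply: ext_ob_extend.
  rewrite eg (bool_irrelevance (ext_len_star hB f) (len_star hB f)).
  exact: (@star_comp CC (base B) (base A) (base D) hB f g).
by rewrite eg psh_comp tele_last_extend.
Qed.

Lemma ext_q_comp (B A D : ext_cat) (hB : 0 < ext_len B)
  (f : mor A (ext_ft B)) (g : mor D A) :
  ext_q hB (g ;; f)
  ≡ ext_q (ext_len_star hB f) (cast_cod (esym (ext_ft_star hB f)) g)
    ;; ext_q hB f.
Proof.
apply: ext_arrow_eq (ext_star_comp hB f g) erefl _ => /=; rewrite /ext_q /=.
pose e : base A = base (ext_ft (ext_star hB f)) :=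
  esym (@ft_star CC (base B) (base A) hB f).
rewrite (ext_cast_cod _ e).
rewrite (bool_irrelevance (ext_len_star hB f) (len_star hB _)).
exact: (@q_comp CC (base B) (base A) (base D) hB f g).
Qed.

Definition extension : C0system :=
  @C0System ext_cat ext_len ext_pt ext_ft ext_p ext_star ext_q
    ext_len_eq0 ext_len_ft_gt0 ext_ft_pt ext_pt_final ext_len_star ext_ft_star
    ext_q_p ext_star_id ext_q_id ext_star_comp ext_q_comp.

End Extension.

(* Main.v *)
From mathcomp Require Import all_boot.
From Stdlib Require Import ProofIrrelevance.
Require Import Defs.

(** A morphism of [CC[F]] is a morphism of [CC] between the underlying objects,
and [ft], [p], [star] and [q] of [CC[F]] lie over those of [CC].  Hence the
section [s_f] of [CC] already has the ends required of a section over
[CC[F]], and the s-operation of [CC] serves unchanged as one on [CC[F]].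

Its axioms are those of [CC], except that the casts are now taken along
equalities of objects of [CC[F]], and that the independence axiom
[s_f = s_(f ;; q(g, Z))] is an equation of arrows, so that the codomains of its
two sides have to agree as objects of [CC[F]], contexts included.  This
agreement is not special to [CC[F]]: in any C0-system the codomains agree by
functoriality of [star] ([star_ft_mor_q]), and [CC[F]] is a C0-system. *)

Set Implicit Arguments.
Unset Strict Implicit.
Unset Printing Implicit Defensive.

Local Open Scope csys_scope.

(** Pulling [Z] back along [f ;; q(g, Z) ;; p_Z = (f ;; p_X) ;; g] is pulling
[X = g^*(Z)] back along [f ;; p_X].  The domain of [g] is a variable [W], not
[ft X], so that [X] can be eliminated along [e]. *)
Lemma star_ft_mor_q (CC : C0system) (X Y Z W : CC) (hX : 0 < len X)
    (hZ : 0 < len Z) (g : mor W (ft Z)) (e : X = star hZ g) (f : mor Y X) :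
  star hX (ft_mor f) = star hZ (ft_mor (cast_cod e f ;; q hZ g)).
Proof.
have e' := esym e; case: X / e' hX e f => hX e f.
rewrite (proof_irrelevance _ e erefl) /ft_mor /= -comp_assoc q_p comp_assoc.
rewrite [RHS]star_comp (bool_irrelevance (len_star hZ g) hX); congr star.
move: (ft_star hZ g) hX f {e}; move: (star hZ g) => X E _ f.
by case: W / E {g}.
Qed.

Theorem lemma0p3p4 (CC : C0system) (hCC : is_Csystem CC) (F : presheaf CC) :
  is_Csystem (extension F).
Proof.
case: hCC => S.
pose sF (X Y : extension F) (hX : 0 < len X) (f : mor Y X) :
    mor Y (star hX (ft_mor f)) := @s CC S (base X) (base Y) hX f.
constructor; apply: (@SOperation (extension F) sF).
- move=> X Y hX f.
  pose e : base (ft (star hX (ft_mor f))) = base Y :=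
    @ft_star CC (base X) (base Y) hX (@ft_mor CC (base X) (base Y) f).
  rewrite [LHS](ext_cast_cod _ e).
  exact: (@s_p CC S (base X) (base Y) hX f).
- by move=> X Y hX f; exact: (@s_q CC S (base X) (base Y) hX f).
move=> X Y Z hX hZ g e f.
apply: ext_arrow_eq erefl (star_ft_mor_q hX e f) _.
pose e0 : base X = base (star hZ g) := congr1 (@base CC F) e.
rewrite /sF /= (ext_cast_cod _ e0).
exact: (@s_star CC S (base X) (base Y) (base Z) hX hZ g e0 f).
Qed.
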